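(* Consider the mixed Hegselmann-Krause model with $n$ agents, opinions in $\mathbf{R}^d$, confidence bound $\epsilon>0$ and stubbornness degrees $\alpha_i(t)\in[0,1]$. Assume that $$\sup_{t\in\mathbf{N}}\ \max_{i\in[n]}\alpha_i(t)<1.$$ For $\delta>0$ let $$\tau_{\alpha,\delta}=\inf\{t\ge 0:\text{every component of }\mathscr{G}(t)\text{ is }\delta\text{-trivial}\}.$$ Then: (1) for every $\delta>0$, $\tau_{\alpha,\delta}$ is bounded from above, by a finite constant that does not depend on the initial opinions $x(0)$; (2) for every trajectory, letting $\tau_m=\tau_{\alpha,\epsilon/m}$ for integers $m\ge 4$, there is an integer $M\ge 4$ such that there is no interaction between any two components of $\mathscr{G}(t)$ at the next time step for all $t\ge\tau_M$, i.e., $$\mathscr{G}(t)=\mathscr{G}(\tau_M)\quad\text{for all } t\ge\tau_M;$$ (3) hence $x$ is asymptotically stable: for every trajectory, $x(t)=(x_1(t),\dots,x_n(t))$ converges as $t\to\infty$.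
   Context: Notation: $[n]=\{1,\dots,n\}$ with $n\ge 1$, $\mathbf{N}=\{0,1,2,\dots\}$, $\|\cdot\|$ is the Euclidean norm on $\mathbf{R}^d$; times $t$ range over $\mathbf{N}$, and $\inf\varnothing=\infty$. Mixed Hegselmann-Krause model: given $\epsilon>0$, arbitrary initial opinions $x_1(0),\dots,x_n(0)\in\mathbf{R}^d$ and given numbers $\alpha_i(t)\in[0,1]$ ($i\in[n]$, $t\in\mathbf{N}$), the opinions evolve by $$x_i(t+1)=\alpha_i(t)\,x_i(t)+\frac{1-\alpha_i(t)}{|N_i(t)|}\sum_{j\in N_i(t)}x_j(t),\qquad N_i(t)=\{j\in[n]:\|x_i(t)-x_j(t)\|\le\epsilon\}$$ (so $i\in N_i(t)$). The profile $\mathscr{G}(t)$ is the undirected graph with vertex set $[n]$ and edge set $\{ij: i\ne j,\ \|x_i(t)-x_j(t)\|\le\epsilon\}$. For $\delta>0$, a (connected) component $G$ of $\mathscr{G}(t)$ is $\delta$-trivial if $\|x_i(t)-x_j(t)\|\le\delta$ for all vertices $i,j$ of $G$. Two distinct components of $\mathscr{G}(t)$ interact at the next time step if some edge of $\mathscr{G}(t+1)$ joins a vertex of one to a vertex of the other. *)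

(* Defs.v *)
(* MathComp / MathComp-Analysis *)
From HB Require Import structures.
From mathcomp Require Export all_boot all_order all_algebra.
From mathcomp Require Export all_classical all_reals all_analysis.
Set Implicit Arguments.
Unset Strict Implicit.
Unset Printing Implicit Defensive.
Import Order.TTheory GRing.Theory Num.Theory.
Import numFieldNormedType.Exports.
Local Open Scope ring_scope.

(* The library norm `|v| on 'rV[R]_d is the sup norm. *)
Definition enorm (R : realType) (d : nat) (v : 'rV[R]_d) : R :=
  Num.sqrt (\sum_(k < d) v 0 k ^+ 2).

(* A configuration (x_1, ..., x_n) of n opinions in R^d is a matrix in
   'M[R]_(n, d) whose i-th row is the opinion of agent i. *)
Definition dist (R : realType) (n d : nat) (x : 'M[R]_(n, d)) (i j : 'I_n) : R :=
  enorm (row i x - row j x).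

Definition nbh (R : realType) (n d : nat) (eps : R) (x : 'M[R]_(n, d))
    (i : 'I_n) : {set 'I_n} :=
  [set j | dist x i j <= eps]%SET.

Definition hk_step (R : realType) (n d : nat) (eps : R) (a : 'I_n -> R)
    (x : 'M[R]_(n, d)) : 'M[R]_(n, d) :=
  \matrix_(i < n) (a i *: row i x
    + ((1 - a i) / #|nbh eps x i|%:R) *: (\sum_(j in nbh eps x i) row j x)).

(* alpha t i is the stubbornness degree of agent i at time t. *)
Fixpoint trajectory (R : realType) (n d : nat) (eps : R)
    (alpha : nat -> 'I_n -> R) (x0 : 'M[R]_(n, d)) (t : nat) : 'M[R]_(n, d) :=
  if t is s.+1 then hk_step eps (alpha s) (trajectory eps alpha x0 s) else x0.

(* The profile, given by its adjacency relation on the fixed vertex set 'I_n: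
   two profiles are equal iff these relations agree pointwise (=2). *)
Definition profile (R : realType) (n d : nat) (eps : R) (x : 'M[R]_(n, d)) :
    rel 'I_n :=
  fun i j => (i != j) && (dist x i j <= eps).

Definition components (n : nat) (e : rel 'I_n) : {set {set 'I_n}} :=
  equivalence_partition (connect e) [set: 'I_n]%SET.

Definition delta_trivial (R : realType) (n d : nat) (delta : R)
    (x : 'M[R]_(n, d)) (C : {set 'I_n}) : Prop :=
  forall i j, i \in C -> j \in C -> dist x i j <= delta.

Definition all_delta_trivial (R : realType) (n d : nat) (eps delta : R)
    (x : 'M[R]_(n, d)) : Prop :=
  forall C, C \in components (profile eps x) -> delta_trivial delta x C.

(* ereal_inf of the empty set is +oo. *)
Definition tau (R : realType) (n d : nat) (eps : R) (alpha : nat -> 'I_n -> R)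
    (x0 : 'M[R]_(n, d)) (delta : R) : \bar R :=
  ereal_inf [set (t%:R)%:E | t in
    [set t : nat | all_delta_trivial eps delta (trajectory eps alpha x0 t)]]%classic.

(* e is the profile at the current time step, e' the one at the next step. *)
Definition interact (n : nat) (e e' : rel 'I_n) (C D : {set 'I_n}) : Prop :=
  [/\ C \in components e, D \in components e, C != D &
      exists i j, [/\ i \in C, j \in D & e' i j]].

(* Main.v *)
Require Import Defs.
From mathcomp Require Import all_boot all_order all_algebra.
From mathcomp Require Import all_classical all_reals all_analysis.
From mathcomp Require Import ring lra.
Import Order.TTheory GRing.Theory Num.Theory.
Import numFieldNormedType.Exports.
Set Implicit Arguments.
Unset Strict Implicit.
Unset Printing Implicit Defensive.
Local Open Scope ring_scope.

(** The argument rests on one Lyapunov function, the truncated energy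
    Z(x) = sum over ordered pairs (i, j) of min(|x_i - x_j|^2, eps^2),
    which lies between 0 and n^2 eps^2 for every configuration.

    One step lowers Z by at least 4 sum_i |x_i(t+1) - x_i(t)|^2
    ([energy_drop]).  Truncation makes pairs that are not neighbours at time t
    harmless, and on neighbouring pairs a discrete Green identity ([green])
    computes the change: the displacement of agent i is a multiple of
    s_i = sum_(j in N_i) (x_i - x_j), the graph Laplacian of the opinions.

    Conversely, small displacements force small components.  By the Green
    identity the Dirichlet sum of |x_i - x_j|^2 over edges equals
    2 sum_i <z_i, s_i>, where z_i is x_i measured from a representative of its
    component, so |z_i| <= n eps.  If some component is not delta-trivial, some
    edge is longer than delta / n, hence the s_i cannot all be small; as the
    stubbornness degrees stay away from 1, the displacements cannot all be
    small either.  So every time step at which the profile is not delta-trivial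
    costs an amount kappa > 0 of energy that depends only on n, eps, delta and
    the bound on the degrees ([energy_dissipation]).

    Consequently the number of times that are not delta-trivial is bounded
    independently of the initial opinions ([unsettled_times_le]).  This gives
    part (1), and also that every trajectory is delta-trivial at all
    sufficiently late times.

    Once all times are eps/4-trivial the profile is frozen
    ([hk_step_profile]): an agent moves by at most eps/4 in a step, so two
    agents at distance more than eps cannot come within eps/4 of each other in
    a single step.  Let S0 be a time from which the profile is constant.  For
    part (2), M is taken so large that any time before S0 which is
    eps/M-trivial is 0-trivial.  Then either tau_M >= S0, or at time tau_M all
    components are single points and nothing moves any more.

    For part (3), while the profile is constant the opinions of a component
    remain in any ball containing them ([trapped]); as the diameters of the
    components tend to 0, the trajectory is Cauchy. *)

(** * Euclidean geometry of row vectors *)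

Section Euclid.
Variables (R : realType) (d : nat).
Implicit Types u v w : 'rV[R]_d.

Definition dot u v : R := \sum_(k < d) u 0 k * v 0 k.

Lemma dotC u v : dot u v = dot v u.
Proof. by apply: eq_bigr => k _; rewrite mulrC. Qed.

Lemma dotDl u v w : dot (u + v) w = dot u w + dot v w.
Proof. by rewrite -big_split; apply: eq_bigr => k _; rewrite mxE mulrDl. Qed.

Lemma dotZl c u w : dot (c *: u) w = c * dot u w.
Proof. by rewrite mulr_sumr; apply: eq_bigr => k _; rewrite mxE mulrA. Qed.

Lemma dotNl u w : dot (- u) w = - dot u w.
Proof. by rewrite -scaleN1r dotZl mulN1r. Qed.

Lemma dotBl u v w : dot (u - v) w = dot u w - dot v w.
Proof. by rewrite dotDl dotNl. Qed.

Lemma dotBr w u v : dot w (u - v) = dot w u - dot w v.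
Proof. by rewrite dotC dotBl !(dotC w). Qed.

Lemma dotZr c w u : dot w (c *: u) = c * dot w u.
Proof. by rewrite dotC dotZl (dotC w). Qed.

Lemma dot_sumr (I : finType) (P : pred I) (F : I -> 'rV[R]_d) w :
  dot w (\sum_(i | P i) F i) = \sum_(i | P i) dot w (F i).
Proof.
rewrite /dot exchange_big; apply: eq_bigr => k _ /=.
by rewrite summxE mulr_sumr.
Qed.

Lemma dot_ge0 u : 0 <= dot u u.
Proof. by apply: sumr_ge0 => k _; rewrite -expr2 sqr_ge0. Qed.

Lemma enorm_ge0 u : 0 <= enorm u.
Proof. exact: sqrtr_ge0. Qed.

Lemma sqr_enorm u : enorm u ^+ 2 = dot u u.
Proof.
rewrite /enorm sqr_sqrtr; first by apply: eq_bigr => k _; rewrite expr2.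
by apply: sumr_ge0 => k _; rewrite sqr_ge0.
Qed.

Lemma enormZ c u : 0 <= c -> enorm (c *: u) = c * enorm u.
Proof.
move=> c0; apply/eqP; rewrite -(@eqrXn2 _ 2) ?enorm_ge0 ?mulr_ge0 ?enorm_ge0//.
by rewrite exprMn !sqr_enorm dotZl dotZr mulrA expr2.
Qed.

Lemma enorm0 : enorm (0 : 'rV[R]_d) = 0.
Proof. by rewrite -(scale0r 0) enormZ // mul0r. Qed.

Lemma enormN u : enorm (- u) = enorm u.
Proof.
by rewrite /enorm; congr Num.sqrt; apply: eq_bigr => k _; rewrite mxE sqrrN.
Qed.

Lemma enorm_eq0 u : enorm u <= 0 -> u = 0.
Proof.
move=> u0; have : dot u u = 0.
  rewrite -sqr_enorm (_ : enorm u = 0) ?expr0n //.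
  by apply/le_anti; rewrite u0 enorm_ge0.
move/eqP; rewrite psumr_eq0 => [/allP z|k _]; last by rewrite -expr2 sqr_ge0.
apply/rowP => k; rewrite mxE; apply/eqP.
by have := z k (mem_index_enum k); rewrite -expr2 sqrf_eq0.
Qed.

(** Weighting the two sides lets the weight be tuned to absorb one of them
    in the energy estimates. *)
Lemma dot_young l u v : 0 < l -> 2 * dot u v <= l * dot u u + l^-1 * dot v v.
Proof.
move=> l0; have := dot_ge0 (l *: u - v).
rewrite !(dotBl, dotBr, dotZl, dotZr) (dotC v u) => h.
rewrite -(ler_pM2l l0) mulrDr (mulrA l l^-1) divff ?gt_eqF // mul1r; lra.
Qed.

Lemma cauchy_schwarz u v : dot u v <= enorm u * enorm v.
Proof.
case: (lerP (enorm u) 0) => [/enorm_eq0 -> | u0].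
  by rewrite enorm0 mul0r -(scale0r 0) dotZl mul0r.
case: (lerP (enorm v) 0) => [/enorm_eq0 -> | v0].
  by rewrite enorm0 mulr0 -(scale0r 0) dotZr mul0r.
rewrite -(ler_pM2l (ltr0n R 2)).
apply: le_trans (dot_young u v (divr_gt0 v0 u0)) _.
rewrite -!sqr_enorm le_eqVlt; apply/orP; left; apply/eqP.
by field; rewrite !gt_eqF.
Qed.

Lemma enormD u v : enorm (u + v) <= enorm u + enorm v.
Proof.
rewrite -(@ler_pXn2r _ 2) ?nnegrE ?addr_ge0 ?enorm_ge0 //.
rewrite sqr_enorm dotDl !(dotC _ (u + v)) !dotDl (dotC v u) -!sqr_enorm.
have := cauchy_schwarz u v; lra.
Qed.

Lemma enorm_sum (I : finType) (P : pred I) (F : I -> 'rV[R]_d) :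
  enorm (\sum_(i | P i) F i) <= \sum_(i | P i) enorm (F i).
Proof.
elim/big_rec2: _ => [|i y z _ h]; first by rewrite enorm0.
by apply: le_trans (enormD _ _) _; rewrite lerD2l.
Qed.

Lemma dot_sub_le u v : dot (u - v) (u - v) <= 2 * dot u u + 2 * dot v v.
Proof.
have := dot_ge0 (u + v).
rewrite !(dotBl, dotBr, dotDl) !(dotC _ (u + v)) !(dotDl) (dotC v u); lra.
Qed.

Lemma coord_le_enorm u k : `|u 0 k| <= enorm u.
Proof.
rewrite -sqrtr_sqr ler_sqrt; last by apply: sumr_ge0 => j _; rewrite sqr_ge0.
rewrite (bigD1 k) //= lerDl; apply: sumr_ge0 => j _; exact: sqr_ge0.
Qed.

End Euclid.

(** * Graph Laplacian identities *)

(** Summation by parts on a graph: over ordered pairs, exchanging i and j turns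
    the terms with a j into the opposite of those with a i.  It is used both
    with a = displacements, for the energy balance, and with a = positions
    relative to the component, for the Dirichlet sum. *)
Lemma green (R : realType) (n d : nat) (N : 'I_n -> {set 'I_n})
    (a b : 'I_n -> 'rV[R]_d) :
  (forall i j, (j \in N i) = (i \in N j)) ->
  \sum_i \sum_(j in N i) dot (a i - a j) (b i - b j)
  = 2 * \sum_i dot (a i) (\sum_(j in N i) (b i - b j)).
Proof.
move=> symN.
have e1 : \sum_i \sum_(j in N i) dot (a i) (b i - b j) =
          \sum_i dot (a i) (\sum_(j in N i) (b i - b j)).
  by apply: eq_bigr => i _; rewrite dot_sumr.
have e2 : \sum_i \sum_(j in N i) dot (a j) (b i - b j) =
          - \sum_i \sum_(j in N i) dot (a i) (b i - b j).
  rewrite (exchange_big_dep xpredT) //= -sumrN.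
  apply: eq_bigr => i _; rewrite -sumrN; apply: eq_big => [j|j _].
    by rewrite symN.
  by rewrite !dotBr opprB.
rewrite -e1; under eq_bigr => i _ do
  (under eq_bigr => j _ do rewrite dotBl; rewrite sumrB).
by rewrite sumrB e2 opprK mulr_natl mulr2n.
Qed.

(** The diagonal terms of the left side vanish, which is why only
    #|N i| - 1 neighbours count; that saved unit is exactly what remains as the
    decrease of the energy in [energy_drop]. *)
Lemma laplacian_energy_le (R : realType) (n d : nat) (N : 'I_n -> {set 'I_n})
    (u : 'I_n -> 'rV[R]_d) :
  (forall i, i \in N i) -> (forall i j, (j \in N i) = (i \in N j)) ->
  \sum_i \sum_(j in N i) dot (u i - u j) (u i - u j)
  <= 4 * \sum_i (#|N i|%:R - 1) * dot (u i) (u i).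
Proof.
move=> reflN symN.
(* Naming the squared norms keeps their own sums out of reach of rewriting. *)
have [A AE] : exists A : 'I_n -> R, forall i, dot (u i) (u i) = A i.
  by exists (fun i => dot (u i) (u i)).
under [in leRHS]eq_bigr => i _ do rewrite AE.
have eA : \sum_i \sum_(j in N i) A j = \sum_i \sum_(j in N i) A i.
  rewrite (exchange_big_dep xpredT) //=.
  by apply: eq_bigr => i _; apply: eq_bigl => j; rewrite symN.
have -> : 4 * \sum_i (#|N i|%:R - 1) * A i =
    \sum_i \sum_(j in N i) (2 * A i + 2 * A j - (if j == i then 4 * A i else 0)).
  transitivity (2 * (\sum_i \sum_(j in N i) A i)
              + 2 * (\sum_i \sum_(j in N i) A j) - \sum_i 4 * A i).
    rewrite eA !mulr_sumr -!big_split /= -sumrB; apply: eq_bigr => i _.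
    by rewrite sumr_const -mulr_natl; ring.
  rewrite !mulr_sumr -!big_split /= -sumrB; apply: eq_bigr => i _.
  rewrite !mulr_sumr -big_split /= sumrB; congr (_ - _).
  rewrite (bigD1 i) //= eqxx big1 ?addr0 // => j /andP[_ /negbTE ->] //.
apply: ler_sum => i _; apply: ler_sum => j _; case: eqP => [->|_].
  by rewrite subrr -(scale0r (u i)) dotZl mul0r; lra.
by rewrite subr0 -!AE; exact: dot_sub_le.
Qed.

(** * Configurations and one step of the dynamics *)

Section Step.
Variables (R : realType) (n d : nat).
Implicit Types (x : 'M[R]_(n, d)) (a : 'I_n -> R) (i j : 'I_n).

Lemma dist_ge0 x i j : 0 <= dist x i j.
Proof. exact: enorm_ge0. Qed.

Lemma distC x i j : dist x i j = dist x j i.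
Proof. by rewrite /dist -enormN opprB. Qed.

Lemma distxx x i : dist x i i = 0.
Proof. by rewrite /dist subrr enorm0. Qed.

Lemma dist_triangle x i j k : dist x i k <= dist x i j + dist x j k.
Proof.
have -> : dist x i k = enorm ((row i x - row j x) + (row j x - row k x)).
  by rewrite /dist addrA subrK.
exact: enormD.
Qed.

Lemma nbh_sym eps x i j : (j \in nbh eps x i) = (i \in nbh eps x j).
Proof. by rewrite !inE distC. Qed.

Lemma nbh_refl eps x i : 0 <= eps -> i \in nbh eps x i.
Proof. by rewrite inE distxx. Qed.

Lemma card_nbh_gt0 eps x i : 0 <= eps -> (0 < #|nbh eps x i|)%N.
Proof. by move=> e0; apply/card_gt0P; exists i; exact: nbh_refl. Qed.

Lemma profile_sym eps x : symmetric (profile eps x).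
Proof. by move=> i j; rewrite /profile eq_sym distC. Qed.

Lemma nbh_connect eps x i j : j \in nbh eps x i -> connect (profile eps x) i j.
Proof.
rewrite inE => h; case: (eqVneq i j) => [->//|ij].
by apply: connect1; rewrite /profile ij.
Qed.

Lemma in_components (e : rel 'I_n) (C : {set 'I_n}) i j : symmetric e ->
  C \in components e -> i \in C -> (j \in C) = connect e i j.
Proof.
move=> /sym_connect_sym esym /imsetP[k _ ->]; rewrite !inE /= => ki.
by rewrite (same_connect esym ki).
Qed.

Lemma all_delta_trivialP eps delta x :
  all_delta_trivial eps delta x <->
  forall i j, connect (profile eps x) i j -> dist x i j <= delta.
Proof.
split=> [h i j ij | h C HC i j iC jC]; last first.
  by apply: h; rewrite -(in_components _ (profile_sym eps x) HC iC).
pose C := [set k in [set: 'I_n] | connect (profile eps x) i k]%SET.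
apply: (h C); first by apply/imsetP; exists i; rewrite ?inE.
  by rewrite !inE connect0.
by rewrite !inE.
Qed.

(** A simple path visits at most n vertices. *)
Lemma dist_connect_le (e : rel 'I_n) x (eta : R) i j : 0 <= eta ->
  (forall k l, e k l -> dist x k l <= eta) ->
  connect e i j -> dist x i j <= n%:R * eta.
Proof.
move=> eta0 h /connectP[p ep ->]; case/shortenP: ep => p' ep' up' _.
have sz : (size p' <= n)%N.
  by apply: ltnW; rewrite -[leqRHS](card_ord n) -/(size (i :: p'))
    -(card_uniqP up') max_card.
apply: (@le_trans _ _ ((size p')%:R * eta)); last by rewrite ler_wpM2r // ler_nat.
elim: p' i ep' {up' sz} => [|k p' IH] i /=; first by rewrite distxx mul0r.
move=> /andP[eik ep']; apply: le_trans (dist_triangle x i k _) _.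
by rewrite -natr1 mulrDl mul1r addrC lerD ?IH ?h.
Qed.

(** Oriented backwards, so that it is a nonnegative multiple of [laplacian]. *)
Definition displacement eps a x i := row i x - row i (hk_step eps a x).

Definition laplacian eps x i := \sum_(j in nbh eps x i) (row i x - row j x).

Lemma displacement_laplacian eps a x i : 0 <= eps ->
  displacement eps a x i = ((1 - a i) / #|nbh eps x i|%:R) *: laplacian eps x i.
Proof.
move=> e0; rewrite /displacement /laplacian rowK sumrB sumr_const scalerBr.
rewrite -[row i x *+ _]scaler_nat scalerA.
rewrite divfK ?pnatr_eq0 -?lt0n ?card_nbh_gt0 //.
by rewrite scalerBl scale1r opprD addrA.
Qed.

(** The new opinion is a convex combination of the opinions of the neighbours. *)
Lemma hk_step_ball eps a x i p (r : R) : 0 <= eps -> 0 <= a i <= 1 ->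
  (forall j, j \in nbh eps x i -> enorm (row j x - p) <= r) ->
  enorm (row i (hk_step eps a x) - p) <= r.
Proof.
move=> e0 /andP[a0 a1] h; set N := nbh eps x i.
have N0 : (0 : R) < #|N|%:R by rewrite ltr0n card_nbh_gt0.
have -> : row i (hk_step eps a x) - p = a i *: (row i x - p)
    + ((1 - a i) / #|N|%:R) *: \sum_(j in N) (row j x - p).
  rewrite rowK sumrB sumr_const !scalerBr -[p *+ _]scaler_nat scalerA.
  rewrite divfK ?gt_eqF // addrACA; congr (_ + _).
  by rewrite -opprD -scalerDl addrCA subrr addr0 scale1r.
apply: le_trans (enormD _ _) _.
rewrite !enormZ ?divr_ge0 ?subr_ge0 ?(ltW N0) //.
have s : enorm (\sum_(j in N) (row j x - p)) <= #|N|%:R * r.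
  apply: le_trans (enorm_sum _ _) _.
  by rewrite mulr_natl -sumr_const; apply: ler_sum => j; exact: h.
have {}s : (1 - a i) / #|N|%:R * enorm (\sum_(j in N) (row j x - p))
    <= (1 - a i) * r.
  apply: le_trans (ler_wpM2l _ s) _; first by rewrite divr_ge0 ?subr_ge0 // ltW.
  by rewrite mulrA divfK ?gt_eqF.
apply: le_trans (lerD (ler_wpM2l a0 (h i (nbh_refl x i e0))) s) _.
by rewrite -mulrDl addrCA subrr addr0 mul1r.
Qed.

(** * The truncated energy and its dissipation *)

Definition energy eps x : R :=
  \sum_i \sum_j Num.min (dist x i j ^+ 2) (eps ^+ 2).

Lemma energy_ge0 eps x : 0 <= energy eps x.
Proof.
by apply: sumr_ge0 => i _; apply: sumr_ge0 => j _; rewrite le_min !sqr_ge0.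
Qed.

Lemma energy_le eps x : energy eps x <= (n * n)%:R * eps ^+ 2.
Proof.
have -> : (n * n)%:R * eps ^+ 2 = \sum_(i < n) \sum_(j < n) eps ^+ 2.
  by rewrite !sumr_const card_ord -mulrnA mulr_natl.
by apply: ler_sum => i _; apply: ler_sum => j _; rewrite ge_min lexx orbT.
Qed.

(** On an edge, with X = x_i - x_j and Y the difference of the displacements,
    |X|^2 - |X - Y|^2 = 2 <Y, X> - |Y|^2.  The first terms sum to
    4 sum_i <u_i, s_i> by [green], at least 4 sum_i #|N_i| |u_i|^2, and the second
    ones are controlled by [laplacian_energy_le]. *)
Lemma energy_drop eps a x : 0 < eps -> (forall i, 0 <= a i <= 1) ->
  4 * \sum_i dot (displacement eps a x i) (displacement eps a x i)
  <= energy eps x - energy eps (hk_step eps a x).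
Proof.
move=> e0 ha; set u := displacement eps a x; set y := hk_step eps a x.
set N := nbh eps x.
have Nr i : i \in N i by apply/nbh_refl/ltW.
have Ns i j : (j \in N i) = (i \in N j) by exact: nbh_sym.
apply: (@le_trans _ _ (\sum_i \sum_(j in N i)
   (dot (row i x - row j x) (row i x - row j x)
    - dot (row i y - row j y) (row i y - row j y)))); last first.
  rewrite /energy -sumrB; apply: ler_sum => i _.
  rewrite -sumrB big_mkcond /=; apply: ler_sum => j _.
  (* A pair of non-neighbours already has the maximal term eps^2. *)
  rewrite -!sqr_enorm -/(dist x i j) -/(dist y i j) inE; case: ifP => [h|/negbT].
    rewrite min_l ?ler_sqr ?nnegrE ?dist_ge0 ?(ltW e0) //.
    by rewrite lerB // ge_min lexx.
  rewrite -ltNge => h; rewrite min_r ?subr_ge0 ?ge_min ?lexx ?orbT //.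
  by rewrite ler_sqr ?nnegrE ?dist_ge0 ?ltW // (lt_trans e0).
have -> : \sum_i \sum_(j in N i)
   (dot (row i x - row j x) (row i x - row j x)
    - dot (row i y - row j y) (row i y - row j y)) =
   4 * (\sum_i dot (u i) (laplacian eps x i))
   - \sum_i \sum_(j in N i) dot (u i - u j) (u i - u j).
  rewrite (_ : 4 = 2 * 2); last by ring.
  rewrite -mulrA -(green _ _ Ns) mulr_sumr -sumrB; apply: eq_bigr => i _.
  rewrite mulr_sumr -sumrB; apply: eq_bigr => j _.
  have -> : row i y - row j y = (row i x - row j x) - (u i - u j).
    by rewrite /u /displacement -/y !opprB !addrA; apply/rowP => k; rewrite !mxE; ring.
  move: (row i x - row j x) (u i - u j) => X Y.
  by rewrite dotBl !dotBr (dotC X Y); ring.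
have key i : #|N i|%:R * dot (u i) (u i) <= dot (u i) (laplacian eps x i).
  have /andP[a0 a1] := ha i.
  rewrite /u displacement_laplacian ?(ltW e0) // dotZr !dotZl -/(N i).
  set c := (1 - a i) / _; set q := dot _ _.
  have N0 : (0 : R) < #|N i|%:R by rewrite ltr0n card_nbh_gt0 ?ltW.
  have c0 : 0 <= c by rewrite divr_ge0 ?subr_ge0 // ltW.
  have q0 : 0 <= q by exact: dot_ge0.
  rewrite mulrA mulrC ler_piMr ?(mulr_ge0 c0 q0) //.
  by rewrite /c mulrCA divff ?gt_eqF // mulr1; lra.
have := laplacian_energy_le u Nr Ns.
have : \sum_i #|N i|%:R * dot (u i) (u i) <= \sum_i dot (u i) (laplacian eps x i).
  by apply: ler_sum => i _; exact: key.
have -> : \sum_i (#|N i|%:R - 1) * dot (u i) (u i) =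
  \sum_i #|N i|%:R * dot (u i) (u i) - \sum_i dot (u i) (u i).
  by rewrite -sumrB; apply: eq_bigr => i _; ring.
lra.
Qed.

(** The constant kappa comes before the configuration: this uniformity is what
    makes the settling time independent of the initial opinions. *)
Lemma energy_dissipation eps delta amax : 0 < eps -> 0 < delta -> amax < 1 ->
  exists2 kappa : R, 0 < kappa & forall a x,
    (forall i, 0 <= a i <= amax) -> ~ all_delta_trivial eps delta x ->
    kappa <= energy eps x - energy eps (hk_step eps a x).
Proof.
move=> e0 d0 am1; case: (posnP n) => [n0|n0].
  exists 1 => // a x _ []; apply/all_delta_trivialP => i.
  by have := ltn_ord i; rewrite [X in (_ < X)%N]n0.
have nR : (0 : R) < n%:R by rewrite ltr0n.
pose B : R := n%:R / (1 - amax).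
pose v := (delta / n%:R) ^+ 2.
pose D := (n%:R * eps) ^+ 2.
(* Weight for [dot_young]: the part carrying |z_i|^2 <= D then sums to v / 2,
   half of the lower bound v of the Dirichlet sum. *)
pose l := 2 * n%:R * D / v.
have am0 : 0 < 1 - amax by lra.
have B0 : 0 < B by rewrite divr_gt0.
have v0 : 0 < v by rewrite exprn_gt0 // divr_gt0.
have D0 : 0 < D by rewrite exprn_gt0 // mulr_gt0.
have l0 : 0 < l by rewrite divr_gt0 // !mulr_gt0.
exists (2 * v / (l * B ^+ 2)) => [|a x ha ntriv].
  by apply: divr_gt0; apply: mulr_gt0 => //; exact: exprn_gt0.
have ha1 i : 0 <= a i <= 1 by have /andP[-> h] := ha i; rewrite (le_trans h) // ltW.
apply: le_trans (energy_drop x e0 ha1).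
set u := displacement eps a x; set s := laplacian eps x; set N := nbh eps x.
set U := \sum_i _.
have Ns i j : (j \in N i) = (i \in N j) by exact: nbh_sym.
have es := sym_connect_sym (profile_sym eps x).
pose rt := fingraph.root (profile eps x).
pose z i := row i x - row (rt i) x.
have zD i : dot (z i) (z i) <= D.
  rewrite -sqr_enorm ler_sqr ?nnegrE ?enorm_ge0 ?mulr_ge0 ?(ltW nR) ?(ltW e0) //.
  apply: dist_connect_le (ltW e0) _ (connect_root (profile eps x) i) => k j.
  by case/andP.
(* |s_i| is at most B |u_i|, since a i stays below amax. *)
have su i : dot (s i) (s i) <= B ^+ 2 * dot (u i) (u i).
  rewrite /u displacement_laplacian ?(ltW e0) // dotZl dotZr -/(s i) mulrA mulrA.
  rewrite -{1}(mul1r (dot (s i) _)) ler_wpM2r ?dot_ge0 // -mulrA -expr2 -exprMn.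
  rewrite exprn_ege1 // /B.
  have N0 : (0 : R) < #|N i|%:R by rewrite ltr0n card_nbh_gt0 ?ltW.
  rewrite mulf_div ler_pdivlMr ?mulr_gt0 // mul1r mulrC.
  have /andP[a0 a1] := ha i.
  rewrite ler_pM ?(ltW am0) ?(ltW N0) //; last by lra.
  by rewrite ler_nat -[leqRHS](card_ord n) max_card.
have [i [j [Nij hij]]] : exists i j, j \in N i /\ v <= dist x i j ^+ 2.
  apply: contrapT => nex; apply: ntriv; apply/all_delta_trivialP => i j ij.
  rewrite -(divfK (lt0r_neq0 nR) delta) mulrC.
  apply: dist_connect_le ij => [|k m /andP[_ km]]; first by rewrite ltW ?divr_gt0.
  rewrite leNgt; apply/negP => h; apply: nex; exists k, m; split.
    by rewrite inE.
  by rewrite ler_sqr ?nnegrE ?dist_ge0 ?ltW // divr_gt0.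
(* Along an edge the representative is the same, so it cancels in z. *)
have vV : v <= \sum_i \sum_(j in N i) dot (z i - z j) (row i x - row j x).
  have -> : \sum_i \sum_(j in N i) dot (z i - z j) (row i x - row j x) =
            \sum_i \sum_(j in N i) dist x i j ^+ 2.
    apply: eq_bigr => k _; apply: eq_bigr => m Nkm.
    rewrite /dist sqr_enorm; congr dot; rewrite /z /rt.
    have /(fingraph.rootP es) -> := nbh_connect Nkm.
    by apply/rowP => c; rewrite !mxE; ring.
  apply: le_trans hij _; rewrite (bigD1 i) //= (bigD1 j) //= -addrA lerDl.
  apply: addr_ge0; first by apply: sumr_ge0 => m _; rewrite sqr_ge0.
  by apply: sumr_ge0 => k _; apply: sumr_ge0 => m _; rewrite sqr_ge0.
have : v <= l * B ^+ 2 * U + v / 2.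
  apply: le_trans vV _; rewrite (green _ _ Ns) mulr_sumr.
  have -> : v / 2 = \sum_(k < n) l^-1 * D.
    rewrite sumr_const card_ord -mulr_natl /l; field.
    by rewrite /v /D !gt_eqF.
  rewrite mulr_sumr -big_split; apply: ler_sum => k _ /=.
  rewrite dotC -/(s k); apply: le_trans (dot_young _ _ l0) _.
  have l1 : 0 <= l^-1 by rewrite invr_ge0 ltW.
  by rewrite -/(s k) -mulrA; apply: lerD;
    [apply: ler_wpM2l (su k); exact: ltW | exact: ler_wpM2l (zD k)].
move=> h; have lB0 : 0 < l * B ^+ 2 by apply: mulr_gt0 => //; exact: exprn_gt0.
rewrite ler_pdivrMr //; lra.
Qed.

End Step.

(** * When the profile stops changing *)

Section Profiles.
Variables (R : realType) (n d : nat) (eps : R).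
Hypothesis eps_gt0 : 0 < eps.
Implicit Types (x : 'M[R]_(n, d)) (a : 'I_n -> R) (i j : 'I_n).

Lemma hk_step_move_le a x i delta : 0 <= a i <= 1 ->
  all_delta_trivial eps delta x ->
  enorm (row i (hk_step eps a x) - row i x) <= delta.
Proof.
move=> ai /all_delta_trivialP triv; apply: hk_step_ball => // [|j ij].
  exact: ltW.
by rewrite -/(dist x j i) distC; apply/triv/nbh_connect.
Qed.

Lemma hk_step_trivial0 a x : (forall i, 0 <= a i <= 1) ->
  all_delta_trivial eps 0 x -> hk_step eps a x = x.
Proof.
move=> ha triv; apply/row_matrixP => i; apply/eqP; rewrite -subr_eq0.
by apply/eqP/enorm_eq0/hk_step_move_le.
Qed.

(** Two agents move by at most eps/4 each, so a distance at most eps/4 before or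
    after the step is at most 3 eps/4 on the other side; and eps/4-triviality
    turns every distance at most eps inside a component into one at most
    eps/4. *)
Lemma hk_step_profile a x : (forall i, 0 <= a i <= 1) ->
  all_delta_trivial eps (eps / 4) x ->
  all_delta_trivial eps (eps / 4) (hk_step eps a x) ->
  profile eps (hk_step eps a x) =2 profile eps x.
Proof.
move=> ha tx ty i j; set y := hk_step eps a x; have e0 := eps_gt0.
rewrite /profile; case: (eqVneq i j) => //= ij.
have := hk_step_move_le (ha i) tx; have := hk_step_move_le (ha j) tx.
rewrite -/y => mj mi.
have tri (p q r s : 'rV[R]_d) :
    enorm (p - s) <= enorm (p - q) + enorm (q - r) + enorm (r - s).
  have -> : p - s = (p - q) + ((q - r) + (r - s)).
    by rewrite (addrA (q - r)) subrK addrA subrK.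
  by rewrite -[leRHS]addrA; apply: le_trans (enormD _ _) _; rewrite lerD2l enormD.
have nC (u v : 'rV[R]_d) : enorm (u - v) = enorm (v - u).
  by rewrite -enormN opprB.
apply/idP/idP => h.
  have : dist y i j <= eps / 4.
    by move/all_delta_trivialP: ty; apply; apply: connect1; rewrite /profile ij.
  have := tri (row i x) (row i y) (row j y) (row j x).
  rewrite /dist (nC (row i x) (row i y)); lra.
have : dist x i j <= eps / 4.
  by move/all_delta_trivialP: tx; apply; apply: connect1; rewrite /profile ij.
have := tri (row i y) (row i x) (row j x) (row j y).
rewrite /dist (nC (row j x) (row j y)); lra.
Qed.

End Profiles.

Lemma no_interact_same_profile (n : nat) (e e' : rel 'I_n) (C D : {set 'I_n}) :
  symmetric e -> e' =2 e -> ~ interact e e' C D.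
Proof.
move=> esym ee' [HC HD /eqP CD [i [j [iC jD eij]]]]; apply: CD.
have jC : j \in C by rewrite (in_components _ esym HC iC) connect1 -?ee'.
apply/setP => k.
by rewrite (in_components _ esym HC jC) (in_components _ esym HD jD).
Qed.

(** * Trajectories *)

Lemma eventually_of_few_failures (P : nat -> Prop) (K : nat) :
  (forall N, (\sum_(t < N) ~~ `[< P t >] <= K)%N) ->
  exists T, forall t, (T <= t)%N -> P t.
Proof.
move=> hK; apply: contrapT => nex.
suff [N] : exists N, (K < \sum_(t < N) ~~ `[< P t >])%N by rewrite ltnNge hK.
elim: K.+1 => [|k [N hN]]; first by exists 0.
have [t [Nt ut]] : exists t, (N <= t)%N /\ ~ P t.
  apply: contrapT => h; apply: nex; exists N => t Nt.
  by apply: contrapT => ut; apply: h; exists t.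
exists t.+1; rewrite big_ord_recr /= (asboolF ut) addn1 ltnS.
apply: leq_trans hN _.
rewrite -!(big_mkord xpredT (fun t => nat_of_bool (~~ `[< P t >]))).
by rewrite (big_cat_nat (leq0n N) Nt) leq_addr.
Qed.

Section Trajectory.
Variables (R : realType) (n d : nat) (eps : R) (alpha : nat -> 'I_n -> R).
Hypothesis eps_gt0 : 0 < eps.
Hypothesis alpha01 : forall t i, 0 <= alpha t i <= 1.
Implicit Types (x : 'M[R]_(n, d)) (delta : R).

Lemma trajectoryS x0 t : trajectory eps alpha x0 t.+1 =
  hk_step eps (alpha t) (trajectory eps alpha x0 t) :> 'M[R]_(n, d).
Proof. by []. Qed.

Definition settled delta (x0 : 'M[R]_(n, d)) t :=
  all_delta_trivial eps delta (trajectory eps alpha x0 t).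

Lemma tau_first delta x0 t : settled delta x0 t ->
  exists2 T : nat, tau eps alpha x0 delta = (T%:R)%:E &
    (T <= t)%N /\ settled delta x0 T.
Proof.
move=> ht; have ex : exists t, `[< settled delta x0 t >] by exists t; apply/asboolP.
case: (ex_minnP ex) => T /asboolP hT minT; exists T; last first.
  by split => //; apply/minT/asboolP.
apply/le_anti/andP; split.
  by apply: ereal_inf_lbound; exists T.
apply: le_ereal_inf_tmp => _ [s hs <-].
by rewrite lee_fin ler_nat; apply/minT/asboolP.
Qed.

(** The energy starts below n^2 eps^2, never increases, and loses kappa at each
    unsettled time. *)
Lemma unsettled_times_le amax delta : amax < 1 ->
  (forall t i, alpha t i <= amax) -> 0 < delta ->
  exists K : nat, forall x0 N,
    (\sum_(t < N) ~~ `[< settled delta x0 t >] <= K)%N.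
Proof.
move=> am1 ham d0.
have [kappa k0 drop] := energy_dissipation n d eps_gt0 d0 am1.
exists (Num.truncn ((n * n)%:R * eps ^+ 2 / kappa)) => x0 N.
rewrite truncn_ge_nat; last first.
  by apply: divr_ge0 (ltW k0); apply: mulr_ge0 => //; exact: sqr_ge0.
rewrite ler_pdivlMr //; set X := trajectory eps alpha x0.
suff : (\sum_(t < N) ~~ `[< settled delta x0 t >])%:R * kappa
    <= energy eps (X 0) - energy eps (X N).
  have := energy_le eps (X 0); have := energy_ge0 eps (X N); lra.
elim: N => [|N IH]; first by rewrite big_ord0 mul0r subrr.
rewrite big_ord_recr /= natrD mulrDl.
suff : (~~ `[< settled delta x0 N >])%:R * kappa
    <= energy eps (X N) - energy eps (X N.+1) by lra.
case: asboolP => [_|uns] /=.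
  rewrite mul0r; apply: le_trans (energy_drop _ eps_gt0 (alpha01 N)).
  by rewrite mulr_ge0 // sumr_ge0 // => i _; exact: dot_ge0.
rewrite mul1r; apply: drop => // i.
by rewrite ham andbT; case/andP: (alpha01 N i).
Qed.

Lemma eventually_settled amax delta x0 : amax < 1 ->
  (forall t i, alpha t i <= amax) -> 0 < delta ->
  exists T, forall t, (T <= t)%N -> settled delta x0 t.
Proof.
move=> am1 ham d0; have [K hK] := unsettled_times_le am1 ham d0.
exact: (eventually_of_few_failures (hK x0)).
Qed.

Lemma eventually_same_profile amax x0 : amax < 1 ->
  (forall t i, alpha t i <= amax) ->
  exists T, forall t, (T <= t)%N ->
    profile eps (trajectory eps alpha x0 t)
    =2 profile eps (trajectory eps alpha x0 T).
Proof.
move=> am1 ham.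
have [T hT] := eventually_settled x0 am1 ham (divr_gt0 eps_gt0 (ltr0n R 4)).
exists T => t /subnK <-; elim: (t - T)%N => [//|s IH] i j.
rewrite -IH addSn.
have h0 := hT _ (leq_addl s T).
have h1 : settled (eps / 4) x0 (s + T).+1 by apply: hT; rewrite -addSn leq_addl.
exact: (hk_step_profile eps_gt0 (alpha01 (s + T)) h0 h1).
Qed.

(** With a constant profile, the ball of radius delta around x_i(T) contains all
    opinions of the component of i at time T, hence at all later times. *)
Lemma trapped T delta x0 :
  (forall t, (T <= t)%N -> profile eps (trajectory eps alpha x0 t)
                           =2 profile eps (trajectory eps alpha x0 T)) ->
  settled delta x0 T -> forall t i, (T <= t)%N ->
  enorm (row i (trajectory eps alpha x0 t) - row i (trajectory eps alpha x0 T))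
  <= delta.
Proof.
set X := trajectory eps alpha x0; move=> same /all_delta_trivialP triv t i Tt.
suff : forall j, connect (profile eps (X T)) i j ->
  enorm (row j (X t) - row i (X T)) <= delta by apply.
move: Tt => /subnK <-; elim: (t - T)%N => [|s IH] j ij.
  by rewrite -/(dist _ j i) distC; exact: triv.
rewrite addSn; apply: hk_step_ball => [||k jk]; first exact: ltW.
  exact: alpha01.
apply: IH; apply: connect_trans ij _; have := nbh_connect jk.
by rewrite (eq_connect (same _ (leq_addl s T))).
Qed.

Lemma trajectory_cvg amax x0 : amax < 1 ->
  (forall t i, alpha t i <= amax) -> cvgn (trajectory eps alpha x0).
Proof.
move=> am1 ham; apply/cauchy_cvgP/cauchy_exP => e e0.
have [T0 hT0] := eventually_same_profile x0 am1 ham.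
have e2 : 0 < e / 2 by lra.
have [T1 hT1] := eventually_settled x0 am1 ham e2.
pose T := maxn T0 T1.
exists (trajectory eps alpha x0 T).
exists T => // t /= Tt.
split => // i j.
have same t' : (T <= t')%N -> profile eps (trajectory eps alpha x0 t')
    =2 profile eps (trajectory eps alpha x0 T).
  move=> Tt' k l; rewrite hT0 ?(leq_trans _ Tt') ?leq_maxl //.
  by rewrite hT0 ?leq_maxl.
have := trapped same (hT1 _ (leq_maxr _ _)) i Tt.
have := coord_le_enorm
  (row i (trajectory eps alpha x0 t) - row i (trajectory eps alpha x0 T)) j.
rewrite !mxE -ball_normE /ball_ /= distrC; lra.
Qed.

(** At each of the finitely many times s < S0 either all components are points,
    or some component has a positive diameter and is not eps/M-trivial for M
    large; M dominates all these thresholds. *)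
Lemma profile_constant_from_tau amax x0 : amax < 1 ->
  (forall t i, alpha t i <= amax) ->
  exists M T : nat, [/\ (4 <= M)%N, tau eps alpha x0 (eps / M%:R) = (T%:R)%:E &
    forall t, (T <= t)%N -> profile eps (trajectory eps alpha x0 t)
                            =2 profile eps (trajectory eps alpha x0 T)].
Proof.
move=> am1 ham; set X := trajectory eps alpha x0.
have [S0 hS0] := eventually_same_profile x0 am1 ham.
have [M M4 hM] : exists2 M : nat, (4 <= M)%N & forall s, (s < S0)%N ->
    settled (eps / M%:R) x0 s -> settled 0 x0 s.
  elim: (S0) => [|S [M M4 hM]]; first by exists 4%N.
  case: (pselect (settled 0 x0 S)) => [h|h].
    exists M => [|s]; first exact: M4.
    by rewrite ltnS leq_eqVlt => /orP[/eqP-> _ | /hM]; [exact: h | exact].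
  have [m hm] : exists m : nat,
      forall M : nat, (m <= M)%N -> ~ settled (eps / M%:R) x0 S.
    have [i [j [ij dij]]] : exists i j,
        connect (profile eps (X S)) i j /\ 0 < dist (X S) i j.
      apply: contrapT => nex; apply: h; apply/all_delta_trivialP => i j ij.
      by rewrite leNgt; apply/negP => dij; apply: nex; exists i, j.
    exists (Num.truncn (eps / dist (X S) i j)).+1 => M'.
    rewrite truncn_lt_nat; last by rewrite ltW ?divr_gt0.
    rewrite ltr_pdivrMr // => lt /all_delta_trivialP /(_ _ _ ij).
    have M'0 : (0 : R) < M'%:R.
      by case: M' lt => [|M' _ //]; rewrite mul0r ltNge (ltW eps_gt0).
    by rewrite ler_pdivlMr // mulrC leNgt lt.
  exists (maxn M m); first by rewrite leq_max M4.
  move=> s; rewrite ltnS leq_eqVlt => /orP[/eqP->/hm|sS hs].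
    by move=> /(_ (leq_maxr _ _)).
  apply: (hM s sS); apply/all_delta_trivialP => i j ij.
  move/all_delta_trivialP: hs => /(_ _ _ ij) h'; apply: le_trans h' _.
  rewrite ler_wpM2l ?(ltW eps_gt0) // lef_pV2 ?posrE ?ltr0n ?ler_nat ?leq_maxl //.
    by rewrite leq_max (leq_trans _ M4).
  exact: leq_trans M4.
have M0 : 0 < eps / M%:R by rewrite divr_gt0 // ltr0n (leq_trans _ M4).
have [t0 /(_ _ (leqnn _)) ht0] := eventually_settled x0 am1 ham M0.
have [T tauT [_ hT]] := tau_first ht0.
exists M, T; split => // t Tt; case: (leqP S0 T) => [ST|TS].
  by move=> i j; rewrite hS0 ?(leq_trans ST) // [RHS]hS0.
have triv := hM _ TS hT; suff -> : X t = X T by [].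
move: Tt => /subnK <-; elim: (t - T)%N => [//|s IH].
rewrite addSn /X trajectoryS -/X IH.
exact: (hk_step_trivial0 eps_gt0 (alpha01 _) triv).
Qed.

End Trajectory.

Lemma stubbornness_bound (R : realType) (n : nat) (alpha : nat -> 'I_n -> R) :
  (forall t i, 0 <= alpha t i <= 1) ->
  let m := sup (range (fun t : nat => \big[Num.max/0]_(i < n) alpha t i)) in
  forall t i, alpha t i <= m.
Proof.
move=> h /= t i; apply: (@le_trans _ _ (\big[Num.max/0]_(i < n) alpha t i)).
  exact: le_bigmax.
apply: ub_le_sup; last by exists t.
exists 1 => _ [s _ <-]; apply: bigmax_le => // j _.
by case/andP: (h s j).
Qed.

Theorem corollary1 (R : realType) (n d : nat) (hn : (0 < n)%N)
    (eps : R) (heps : 0 < eps)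
    (alpha : nat -> 'I_n -> R)
    (halpha : forall t i, 0 <= alpha t i <= 1)
    (hsup : sup (range (fun t : nat => \big[Num.max/0]_(i < n) alpha t i)) < 1) :
  [/\ (forall delta : R, 0 < delta ->
         exists K : R, forall x0 : 'M[R]_(n, d),
           (tau eps alpha x0 delta <= K%:E)%E),
      (forall x0 : 'M[R]_(n, d),
         exists M : nat, (4 <= M)%N /\
         exists T : nat,
           [/\ tau eps alpha x0 (eps / M%:R) = (T%:R)%:E,
               (forall t : nat, (T <= t)%N ->
                  ~ exists C D : {set 'I_n},
                      interact (profile eps (trajectory eps alpha x0 t))
                               (profile eps (trajectory eps alpha x0 t.+1)) C D)
             & (forall t : nat, (T <= t)%N ->
                  profile eps (trajectory eps alpha x0 t)
                  =2 profile eps (trajectory eps alpha x0 T))])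
    & (forall x0 : 'M[R]_(n, d), cvgn (trajectory eps alpha x0))].
Proof.
have ham := stubbornness_bound halpha.
split=> [delta d0 | x0 | x0]; last exact: trajectory_cvg hsup ham.
  have [K hK] := unsettled_times_le d heps halpha hsup ham d0.
  exists K%:R => x0.
  have [t tK ht] : exists2 t, (t <= K)%N & settled eps alpha delta x0 t.
    apply: contrapT => nex; have := hK x0 K.+1; rewrite leqNgt => /negP; apply.
    apply: (@leq_trans (\sum_(t < K.+1) 1)); first by rewrite sum1_card card_ord.
    apply: leq_sum => t _; case: asboolP => // ht.
    by exfalso; apply: nex; exists t => //; rewrite -ltnS ltn_ord.
  have [T -> [Tt _]] := tau_first ht.
  by rewrite lee_fin ler_nat (leq_trans Tt).
have [M [T [M4 tauT same]]] := profile_constant_from_tau heps halpha x0 hsup ham.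
exists M; split=> //; exists T; split=> // t Tt [C [D]].
apply: no_interact_same_profile => [|i j]; first exact: profile_sym.
by rewrite same ?(leqW Tt) // [RHS]same.
Qed.
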